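(* Let $G$ be a simple connected graph of order $n$, let $uv\in E(G)$, and let $G'=G-uv+uw+wv$ be the graph obtained by inserting a new vertex $w$ into the edge $uv$. Let $f$ be a harmonic eigenfunction associated with $\rho(\mathcal{L}(G))$. If $f(u)f(v)\geq0$, then $\rho(\mathcal{L}(G))\leq\rho(\mathcal{L}(G'))$, and the inequality is strict if $f(u)f(v)>0$.
   Context: For a simple graph $G$, $A$ is its adjacency matrix, $D$ the diagonal matrix of vertex degrees $d(x)$, $L=D-A$ its Laplacian and $\mathcal{L}(G)=D^{-1/2}LD^{-1/2}$ its normalized Laplacian; $\rho(\mathcal{L}(G))$ is its spectral radius, i.e. its largest eigenvalue. Functions $f:V(G)\to\mathbb{R}$ are viewed as vectors; $e$ is the all-ones vector and $f\perp De$ means $\sum_x d(x)f(x)=0$. With $R(f)=\frac{\sum_{xy\in E(G)}(f(x)-f(y))^2}{\sum_{x}d(x)f(x)^2}$, one has $\rho(\mathcal{L}(G))=\sup_{f\neq0,\,f\perp De}R(f)$; a harmonic eigenfunction associated with $\rho(\mathcal{L}(G))$ is a nonzero $f\perp De$ with $R(f)=\rho(\mathcal{L}(G))$. *)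

(* Defs.v *)
From HB Require Import structures.
From mathcomp Require Import all_boot all_order all_algebra.
From mathcomp Require Import classical_sets reals.

Set Implicit Arguments.
Unset Strict Implicit.
Unset Printing Implicit Defensive.

Import Order.TTheory GRing.Theory Num.Theory.
Local Open Scope ring_scope.

Record sgraph (V : finType) := SGraph {
  adj :> rel V;
  adj_sym : symmetric adj;
  adj_irrefl : irreflexive adj }.

Definition connected_graph (V : finType) (G : sgraph V) : Prop :=
  forall x y : V, connect G x y.

Definition deg (V : finType) (G : sgraph V) (x : V) : nat := #|[set y | G x y]|.

(* G - uv + uw + wv: the new vertex w is [None], an old vertex x is [Some x]. *)
Definition subdivide_adj (V : finType) (G : sgraph V) (u v : V) :
    rel (option V) := fun a b =>
  match a, b with
  | Some x, Some y =>
      G x y && ~~ ((x == u) && (y == v) || (x == v) && (y == u))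
  | Some x, None | None, Some x => (x == u) || (x == v)
  | None, None => false
  end.

Fact subdivide_sym (V : finType) (G : sgraph V) (u v : V) :
  symmetric (subdivide_adj G u v).
Proof.
move=> [x|] [y|] //=; rewrite adj_sym; congr (_ && ~~ _).
by rewrite orbC [(x == v) && _]andbC [(x == u) && _]andbC.
Qed.

Fact subdivide_irrefl (V : finType) (G : sgraph V) (u v : V) :
  irreflexive (subdivide_adj G u v).
Proof. by move=> [x|] //=; rewrite adj_irrefl. Qed.

Definition subdivide (V : finType) (G : sgraph V) (u v : V) :
    sgraph (option V) :=
  SGraph (subdivide_sym G u v) (subdivide_irrefl G u v).

(* Rows and columns are indexed by V through its enumeration [enum_val]. *)
Definition adjmx (R : realType) (V : finType) (G : sgraph V) : 'M[R]_#|V| :=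
  \matrix_(i, j) (G (enum_val i) (enum_val j))%:R.

Definition degmx (R : realType) (V : finType) (G : sgraph V) : 'M[R]_#|V| :=
  diag_mx (\row_i (deg G (enum_val i))%:R).

Definition laplacian (R : realType) (V : finType) (G : sgraph V) :
    'M[R]_#|V| :=
  degmx R G - adjmx R G.

(* D^{-1/2}; an isolated vertex gets the entry 0, since 0^-1 = 0. *)
Definition degmx_isqrt (R : realType) (V : finType) (G : sgraph V) :
    'M[R]_#|V| :=
  diag_mx (\row_i (Num.sqrt (deg G (enum_val i))%:R)^-1).

Definition nlaplacian (R : realType) (V : finType) (G : sgraph V) :
    'M[R]_#|V| :=
  degmx_isqrt R G *m laplacian R G *m degmx_isqrt R G.

(* The largest real eigenvalue: the set of eigenvalues is finite, and nonempty
   when M is symmetric of positive size, so its supremum is then a maximum. *)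
Definition rho (R : realType) (n : nat) (M : 'M[R]_n) : R :=
  sup [set a : R | eigenvalue M a]%classic.

(* The sum over ordered pairs counts every edge twice, whence the 1/2. *)
Definition rayleigh (R : realType) (V : finType) (G : sgraph V) (f : V -> R) : R :=
  (2^-1 * \sum_x \sum_(y | G x y) (f x - f y) ^+ 2) /
  (\sum_x (deg G x)%:R * f x ^+ 2).

Definition harmonic_eigenfunction (R : realType) (V : finType) (G : sgraph V)
    (f : V -> R) : Prop :=
  [/\ exists x, f x != 0,
      \sum_x (deg G x)%:R * f x = 0
    & rayleigh G f = rho (nlaplacian R G)].

(* Main.v *)
Require Import Defs.
From HB Require Import structures.
From mathcomp Require Import all_boot all_order all_algebra.
From mathcomp Require Import classical_sets reals.
From mathcomp Require Import ring lra.

(** Extend [f] by the value 0 at the new vertex. Old vertices keep their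
    degrees, so the weighted norm [M] of [f] does not change, while the edge sum
    gains [f u ^ 2 + f v ^ 2 - (f u - f v) ^ 2 = 2 * f u * f v]. Hence the
    Rayleigh quotient becomes [rho + 2 * f u * f v / M], and it is at most the
    spectral radius of the subdivided graph.

    The last step needs that the supremum [l] of the Rayleigh quotients of a
    symmetric matrix [S] is an eigenvalue. If it were not, [B = l - S] would be
    positive semidefinite and invertible; then [B >= C^-1] for any bound [C] on
    the form of [B^-1], so [l - C^-1] would bound the quotients of [S]. *)

Set Implicit Arguments.
Unset Strict Implicit.
Unset Printing Implicit Defensive.

Import Order.TTheory GRing.Theory Num.Theory.
Local Open Scope ring_scope.

(** * Quadratic forms of real matrices and the largest eigenvalue of a symmetric matrix *)

Definition qform (R : realType) (n : nat) (A : 'M[R]_n) (x : 'rV[R]_n) : R :=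
  (x *m A *m x^T) 0 0.

Definition sqnorm (R : realType) (n : nat) (x : 'rV[R]_n) : R :=
  \sum_i x 0 i ^+ 2.

Section QuadraticForms.
Variables (R : realType) (n : nat).
Implicit Types (A B S : 'M[R]_n) (x y : 'rV[R]_n).

Lemma sqnormE x : sqnorm x = (x *m x^T) 0 0.
Proof. by rewrite mxE; apply: eq_bigr => i _; rewrite mxE expr2. Qed.

Lemma qformE A x : qform A x = \sum_i \sum_j A i j * (x 0 i * x 0 j).
Proof.
rewrite /qform mxE exchange_big; apply: eq_bigr => j _ /=.
rewrite !mxE mulr_suml; apply: eq_bigr => i _.
by ring.
Qed.

Lemma sqnorm_ge0 x : 0 <= sqnorm x.
Proof. by apply: sumr_ge0 => i _; apply: sqr_ge0. Qed.

Lemma sqr_le_sqnorm x i : x 0 i ^+ 2 <= sqnorm x.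
Proof.
by rewrite /sqnorm (bigD1 i) //= lerDl; apply: sumr_ge0 => j _; apply: sqr_ge0.
Qed.

Lemma sqnorm_gt0 x : x != 0 -> 0 < sqnorm x.
Proof.
case/rV0Pn=> i xi; apply: lt_le_trans (sqr_le_sqnorm x i).
by rewrite lt0r sqrf_eq0 xi sqr_ge0.
Qed.

Lemma qform_bounded A :
  exists2 C : R, 0 < C & forall x, qform A x <= C * sqnorm x.
Proof.
have S0 : 0 <= \sum_i \sum_j `|A i j|.
  by apply: sumr_ge0 => i _; apply: sumr_ge0 => j _.
(* The summand 1 keeps the constant positive even when [A] is zero. *)
exists (1 + \sum_i \sum_j `|A i j|) => [|x].
  by rewrite ltr_wpDr.
apply: (@le_trans _ _ ((\sum_i \sum_j `|A i j|) * sqnorm x)); last first.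
  by rewrite ler_wpM2r ?sqnorm_ge0 // lerDr.
rewrite qformE mulr_suml; apply: ler_sum => i _.
rewrite mulr_suml; apply: ler_sum => j _.
apply: le_trans (ler_norm _) _; rewrite normrM ler_wpM2l //.
have := sqr_le_sqnorm x i; have := sqr_le_sqnorm x j.
(* This square gives [2 * |x_i x_j| <= x_i ^ 2 + x_j ^ 2], which is at most [2 * sqnorm x]. *)
have := sqr_ge0 (`|x 0 i| - `|x 0 j|).
rewrite sqrrB !real_normK ?num_real // normrM.
lra.
Qed.

Lemma qform_scalarB (a : R) S x :
  qform (a%:M - S) x = a * sqnorm x - qform S x.
Proof.
by rewrite sqnormE /qform mulmxBr mul_mx_scalar mulmxBl -scalemxAl !mxE.
Qed.

Lemma qform_addZ A x y (t : R) :
  qform A (x + t *: y) =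
    qform A x + t * ((y *m A *m x^T) 0 0 + (x *m A *m y^T) 0 0)
    + t ^+ 2 * qform A y.
Proof.
rewrite /qform linearD linearZ /= !mulmxDl !mulmxDr -!scalemxAl -!scalemxAr.
by rewrite !mxE; ring.
Qed.

Lemma tr_scalar (M : 'M[R]_1) : M^T 0 0 = M 0 0.
Proof. by rewrite mxE. Qed.

Lemma bform_sym A x y :
  A^T = A -> (x *m A *m y^T) 0 0 = (y *m A *m x^T) 0 0.
Proof. by move=> As; rewrite -tr_scalar !trmx_mul trmxK As mulmxA. Qed.

(** With [C] a bound on the form of [B^-1], evaluate the nonnegative form of [B] at
    [x - C^-1 x B^-1]. Each cross product equals [sqnorm x], and the quadratic term is at most
    [C^-1 * sqnorm x]. Hence [qform B x - 2 C^-1 * sqnorm x + C^-1 * sqnorm x >= 0], so [c = C^-1]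
    works. *)
Lemma psd_unitmx_coercive B :
  B^T = B -> (forall x, 0 <= qform B x) -> B \in unitmx ->
  exists2 c : R, 0 < c & forall x, c * sqnorm x <= qform B x.
Proof.
move=> Bsym Bpsd Bu; have [C C0 CP] := qform_bounded (invmx B).
exists C^-1 => [|x]; first by rewrite invr_gt0.
set y := x *m invmx B.
have yBx : (y *m B *m x^T) 0 0 = sqnorm x by rewrite mulmxKV // -sqnormE.
have xBy : (x *m B *m y^T) 0 0 = sqnorm x.
  by rewrite bform_sym.
have yBy : qform B y = qform (invmx B) x.
  by rewrite /qform mulmxKV // -tr_scalar trmx_mul trmxK.
have := Bpsd (x + - C^-1 *: y); rewrite qform_addZ yBx xBy yBy.
have := CP x; rewrite -(ler_pM2l (exprn_gt0 2 (_ : 0 < C^-1))) ?invr_gt0 //.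
have -> : C^-1 ^+ 2 * (C * sqnorm x) = C^-1 * sqnorm x.
  by field; rewrite gt_eqF.
lra.
Qed.

Lemma eigenvalue_qform S (a : R) : eigenvalue S a ->
  exists2 x, x != 0 & qform S x = a * sqnorm x.
Proof.
case/eigenvalueP=> x xS x0; exists x => //.
by rewrite sqnormE /qform xS -scalemxAl mxE.
Qed.

(** Only for a set bounded above is [sup] known to dominate the members; this lets [rho] be compared
    with a given eigenvalue. *)
Lemma eigenvalues_bounded S :
  has_ubound [set a : R | eigenvalue S a]%classic.
Proof.
have [C _ CP] := qform_bounded S; exists C => a /eigenvalue_qform [x x0 Sx].
by have := CP x; rewrite Sx ler_pM2r // sqnorm_gt0.
Qed.

Lemma qform_le_rho S x : S^T = S -> qform S x <= rho S * sqnorm x.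
Proof.
move=> Ssym; have [->|x0] := eqVneq x 0.
  rewrite qformE /sqnorm !big1 ?mulr0 // => i _; first by rewrite mxE expr0n.
  by rewrite big1 // => j _; rewrite !mxE !mulr0.
pose E := [set a : R | exists2 y, y != 0 & a = qform S y / sqnorm y]%classic.
have [C _ CP] := qform_bounded S.
have Eub : has_ubound E.
  exists C => _ [y y0 ->].
  by rewrite ler_pdivrMr ?sqnorm_gt0 // CP.
set l := sup E.
have lP y : qform S y <= l * sqnorm y.
  have [->|y0] := eqVneq y 0.
    rewrite qformE /sqnorm !big1 ?mulr0 // => i _; first by rewrite mxE expr0n.
    by rewrite big1 // => j _; rewrite !mxE !mulr0.
  by rewrite -ler_pdivrMr ?sqnorm_gt0 //; apply: ub_le_sup => //; exists y.
apply: le_trans (lP x) _; rewrite ler_wpM2r ?sqnorm_ge0 //.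
apply: ub_le_sup; first exact: eigenvalues_bounded.
(* If [l%:M - S] is singular, a kernel vector is an eigenvector for [l]; the invertible case is then
   refuted. *)
have [Bu|] := boolP ((l%:M - S) \in unitmx); last first.
  rewrite unitmxE unitfE negbK => /det0P [v v0 vB].
  apply/eigenvalueP; exists v => //; apply/esym/eqP.
  by rewrite -subr_eq0 -mul_mx_scalar -mulmxBr vB.
exfalso.
have [|y|c c0 cP] := psd_unitmx_coercive _ _ Bu.
- by rewrite linearB /= tr_scalar_mx Ssym.
- by rewrite qform_scalarB subr_ge0.
(* Coercivity makes [l - c] an upper bound of [E]; [E] is nonempty because [x] is nonzero, so its
   supremum obeys that bound. *)
have : l <= l - c.
  apply: ge_sup; first by exists (qform S x / sqnorm x), x.
  move=> _ [y y0 ->]; rewrite ler_pdivrMr ?sqnorm_gt0 //.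
  by have := cP y; rewrite qform_scalarB; lra.
lra.
Qed.

End QuadraticForms.

(** * Edge sums and weighted norms of a graph, and the normalized Laplacian *)

Definition dirichlet (R : realType) (V : finType) (G : sgraph V)
    (f : V -> R) : R :=
  2^-1 * \sum_x \sum_(y | G x y) (f x - f y) ^+ 2.

Definition wnorm (R : realType) (V : finType) (G : sgraph V) (f : V -> R) : R :=
  \sum_x (deg G x)%:R * f x ^+ 2.

Section Graphs.
Variables (R : realType) (V : finType).
Implicit Types (G : sgraph V) (f : V -> R) (u v x y : V).

Lemma degE G x : deg G x = (\sum_y G x y)%N.
Proof.
by rewrite /deg -sum1dep_card big_mkcond; apply: eq_bigr => y _; case: (G x y).
Qed.

Lemma deg_gt0 G x y : G x y -> (0 < deg G x)%N.
Proof. by move=> Gxy; apply/card_gt0P; exists y; rewrite inE. Qed.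

(** A vertex other than [u] has the first edge of a path to [u]; [u] itself has the edge to [v]. *)
Lemma connected_deg_gt0 G u v x :
  connected_graph G -> G u v -> (0 < deg G x)%N.
Proof.
move=> Gc Guv; have [->|xu] := eqVneq x u; first exact: deg_gt0 Guv.
have /connectP [[|y p] /=] := Gc x u; first by move=> _ ux; rewrite ux eqxx in xu.
by case/andP=> Gxy _ _; apply: deg_gt0 Gxy.
Qed.

Lemma dirichletE G f :
  dirichlet G f = 2^-1 * \sum_x \sum_y (G x y)%:R * (f x - f y) ^+ 2.
Proof.
congr (_ * _); apply: eq_bigr => x _; rewrite big_mkcond; apply: eq_bigr => y _.
by case: (G x y); rewrite ?mul1r ?mul0r.
Qed.

(** Expanding the squares, the terms in [f x ^+ 2] and in [f y ^+ 2] have equal sums by symmetry of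
    adjacency. Each is the degree term, and the factor 1/2 merges them. *)
Lemma dirichlet_laplacian G f :
  dirichlet G f =
  \sum_x \sum_y ((deg G x)%:R *+ (x == y) - (G x y)%:R) * (f x * f y).
Proof.
have swap : \sum_x \sum_y (G x y)%:R * f y ^+ 2 =
            \sum_x \sum_y (G x y)%:R * f x ^+ 2.
  rewrite exchange_big; apply: eq_bigr => x _; apply: eq_bigr => y _ /=.
  by rewrite adj_sym.
have degs : \sum_x \sum_y (deg G x)%:R *+ (x == y) * (f x * f y) =
            \sum_x \sum_y (G x y)%:R * f x ^+ 2.
  apply: eq_bigr => x _; rewrite (bigD1 x) //= eqxx big1 ?addr0.
    by rewrite mulr1n degE natr_sum mulr_suml.
  by move=> y /negbTE yx; rewrite eq_sym yx mulr0n mul0r.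
rewrite dirichletE.
have expand x y : (G x y)%:R * (f x - f y) ^+ 2 =
    (G x y)%:R * f x ^+ 2 + (G x y)%:R * f y ^+ 2
    - 2 * ((G x y)%:R * (f x * f y)) by ring.
under eq_bigr => x _.
  under eq_bigr => y _ do rewrite expand.
  rewrite sumrB big_split -mulr_sumr /=.
  over.
rewrite sumrB big_split -mulr_sumr /= swap.
under [RHS]eq_bigr => x _ do under eq_bigr => y _ do rewrite mulrBl.
under [RHS]eq_bigr => x _ do rewrite sumrB.
by rewrite sumrB degs; field.
Qed.

Lemma sum_enum_val (F : V -> R) : \sum_x F x = \sum_(i < #|V|) F (enum_val i).
Proof. by rewrite -(big_enum_val (A := V)); apply: eq_bigl. Qed.

Lemma nlaplacian_sym G : (nlaplacian R G)^T = nlaplacian R G.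
Proof.
have Lsym : (laplacian R G)^T = laplacian R G.
  rewrite /laplacian linearB /= tr_diag_mx; congr (_ - _).
  by apply/matrixP => i j; rewrite !mxE adj_sym.
by rewrite /nlaplacian !trmx_mul tr_diag_mx Lsym mulmxA.
Qed.

(** Substituting [x = D^(1/2) f] turns the weighted norm into [sqnorm x] and the edge sum into the
    form of the normalized Laplacian. Positive degrees make [D^(-1/2)] undo the scaling. *)
Lemma dirichlet_le_rho G f : (forall x, (0 < deg G x)%N) ->
  dirichlet G f <= rho (nlaplacian R G) * wnorm G f.
Proof.
move=> dG.
pose x := \row_(i < #|V|)
  (Num.sqrt (deg G (enum_val i))%:R * f (enum_val i)) : 'rV[R]_#|V|.
have sq y : 0 < Num.sqrt (deg G y)%:R :> R by rewrite sqrtr_gt0 ltr0n.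
have -> : wnorm G f = sqnorm x.
  rewrite /wnorm sum_enum_val; apply: eq_bigr => i _.
  by rewrite mxE exprMn sqr_sqrtr // ler0n.
have -> : dirichlet G f = qform (nlaplacian R G) x.
  pose y : 'rV[R]_#|V| := \row_i f (enum_val i).
  have xD : x *m degmx_isqrt R G = y.
    apply/rowP => i; rewrite mul_mx_diag !mxE mulrAC divff ?mul1r //.
    by rewrite gt_eqF.
  have -> : qform (nlaplacian R G) x = qform (laplacian R G) y.
    rewrite /qform /nlaplacian !mulmxA xD -!mulmxA; congr ((y *m (_ *m _)) 0 0).
    by rewrite -xD trmx_mul tr_diag_mx.
  rewrite qformE dirichlet_laplacian sum_enum_val; apply: eq_bigr => i _.
  rewrite sum_enum_val; apply: eq_bigr => j _.
  by rewrite !mxE (inj_eq enum_val_inj).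
exact/qform_le_rho/nlaplacian_sym.
Qed.

Lemma wnorm_gt0 G f x :
  (forall y, (0 < deg G y)%N) -> f x != 0 -> 0 < wnorm G f.
Proof.
move=> dG fx; rewrite /wnorm (bigD1 x) //= ltr_wpDr //.
  by apply: sumr_ge0 => y _; rewrite mulr_ge0 ?ler0n ?sqr_ge0.
by rewrite mulr_gt0 ?ltr0n // lt0r sqrf_eq0 fx sqr_ge0.
Qed.

Lemma sum_option (F : option V -> R) :
  \sum_a F a = F None + \sum_x F (Some x).
Proof.
rewrite (bigD1 None) //=; congr (_ + _).
rewrite (reindex_omap Some id) /=; last by case.
by apply: eq_bigl => x; rewrite eqxx.
Qed.

Lemma sum_delta (F : V -> R) z : \sum_x (x == z)%:R * F x = F z.
Proof.
rewrite (bigD1 z) //= eqxx mul1r big1 ?addr0 // => x /negbTE ->.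
by rewrite mul0r.
Qed.

(** * Degrees and edge sums after the subdivision of an edge *)

Section Subdivide.
Variables (G : sgraph V) (u v : V).
Hypothesis Guv : G u v.

Lemma edge_neq : (u == v) = false.
Proof. by apply: contraTF Guv => /eqP ->; rewrite adj_irrefl. Qed.

(** Writing the deleted edge with Kronecker deltas lets [sum_delta] evaluate sums over it. The two
    products are never both 1, since [u] and [v] differ. *)
Lemma subdivide_Some x y : (subdivide G u v (Some x) (Some y))%:R =
  (G x y)%:R - (x == u)%:R * (y == v)%:R - (x == v)%:R * (y == u)%:R :> R.
Proof.
have uv := edge_neq.
have Gvu : G v u by rewrite adj_sym.
have vu : (v == u) = false by rewrite eq_sym.
rewrite /=; have [->|xu] := eqVneq x u.
  rewrite uv /=; have [->|yv] := eqVneq y v.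
    by rewrite Guv ?vu /=; ring.
  by rewrite ?uv ?andbF ?andbT /=; ring.
have [->|xv] := eqVneq x v; last by rewrite ?uv ?andbF ?andbT /=; ring.
have [->|yu] := eqVneq y u; first by rewrite Gvu /=; ring.
by rewrite ?uv ?andbF ?andbT /=; ring.
Qed.

Lemma subdivide_None x :
  (subdivide G u v (Some x) None)%:R = (x == u)%:R + (x == v)%:R :> R.
Proof.
by rewrite /=; have [->|_] := eqVneq x u; rewrite ?edge_neq ?addr0 ?add0r.
Qed.

End Subdivide.

End Graphs.

(** At [u] and at [v], the new neighbour replaces the lost one. Casting to [R] makes the
    subtractions exact. *)
Lemma deg_subdivide (V : finType) (G : sgraph V) u v x (R : realType) :
  G u v -> (deg (subdivide G u v) (Some x))%:R = (deg G x)%:R :> R.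
Proof.
move=> Guv; rewrite !degE !natr_sum sum_option subdivide_None //.
under [in LHS]eq_bigr => y _ do rewrite subdivide_Some // [_ * (y == v)%:R]mulrC
  [_ * (y == u)%:R]mulrC.
by rewrite !sumrB !sum_delta; ring.
Qed.

Definition extend0 (R : realType) (V : finType) (f : V -> R) (a : option V) : R :=
  if a is Some x then f x else 0.

Lemma wnorm_subdivide (R : realType) (V : finType) (G : sgraph V) u v
    (f : V -> R) :
  G u v -> wnorm (subdivide G u v) (extend0 f) = wnorm G f.
Proof.
move=> Guv; rewrite /wnorm sum_option /= expr0n mulr0 add0r.
by apply: eq_bigr => x _; rewrite deg_subdivide.
Qed.

Lemma dirichlet_subdivide (R : realType) (V : finType) (G : sgraph V) u v
    (f : V -> R) : G u v ->
  dirichlet (subdivide G u v) (extend0 f) = dirichlet G f + 2 * (f u * f v).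
Proof.
move=> Guv; rewrite !dirichletE sum_option sum_option mul0r add0r.
(* The factor in [y] comes first so that the inner sum collapses before the outer one. *)
have old x y : (subdivide G u v (Some x) (Some y))%:R * (f x - f y) ^+ 2 =
    (G x y)%:R * (f x - f y) ^+ 2
    - (y == v)%:R * ((x == u)%:R * (f x - f y) ^+ 2)
    - (y == u)%:R * ((x == v)%:R * (f x - f y) ^+ 2).
  by rewrite subdivide_Some //; ring.
have new : \sum_x (subdivide G u v (Some x) None)%:R * (f x - 0) ^+ 2 =
           f u ^+ 2 + f v ^+ 2.
  under eq_bigr => x _ do rewrite subdivide_None // mulrDl subr0.
  by rewrite big_split /= !(sum_delta (fun x => f x ^+ 2)).
(* The edges at the new vertex, counted from its side, are brought to the form in [new]; the same
   sum reappears from the side of the old vertices. *)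
under eq_bigr => x _ do rewrite adj_sym -sqrrN opprB.
rewrite new.
under eq_bigr => x _.
  rewrite sum_option.
  under eq_bigr => y _ do rewrite old.
  rewrite !sumrB (sum_delta (fun y => (x == u)%:R * (f x - f y) ^+ 2)).
  rewrite (sum_delta (fun y => (x == v)%:R * (f x - f y) ^+ 2)).
  over.
rewrite big_split /= new !sumrB (sum_delta (fun x => (f x - f v) ^+ 2)).
rewrite (sum_delta (fun x => (f x - f u) ^+ 2)).
by field.
Qed.

Theorem theorem4p1 (R : realType) (V : finType) (G : sgraph V) (u v : V)
    (f : V -> R) :
  connected_graph G ->
  G u v ->
  harmonic_eigenfunction G f ->
  0 <= f u * f v ->
  rho (nlaplacian R G) <= rho (nlaplacian R (subdivide G u v)) /\
  (0 < f u * f v ->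
   rho (nlaplacian R G) < rho (nlaplacian R (subdivide G u v))).
Proof.
move=> Gc Guv [[x fx] _ frho] fuv.
have dG y : (0 < deg G y)%N := connected_deg_gt0 y Gc Guv.
have M0 : 0 < wnorm G f := wnorm_gt0 dG fx.
have dG' a : (0 < deg (subdivide G u v) a)%N.
  case: a => [y|]; first by rewrite -(ltr0n R) deg_subdivide // ltr0n.
  by apply: (@deg_gt0 _ _ _ (Some u)); rewrite /= eqxx.
have := dirichlet_le_rho (extend0 f) dG'.
rewrite wnorm_subdivide // dirichlet_subdivide //.
(* Clearing the denominator of the Rayleigh quotient of [f] leaves
   [rho * M + 2 * (f u * f v) <= rho' * M], and both claims follow by cancelling [M > 0]. *)
have -> : dirichlet G f = rho (nlaplacian R G) * wnorm G f.
  by rewrite -frho /rayleigh divfK // gt_eqF.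
move=> H; split=> [|fuv0]; first by rewrite -(ler_pM2r M0); lra.
by rewrite -(ltr_pM2r M0); lra.
Qed.
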